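(* Let $(P,\preceq)$ be a finite poset and for each $x\in P$ let $A_x$ be a unital $C^*$-algebra and $I_x$ an isocone of $A_x$. Put $I=\bigoplus_{x\in P}I_x$ and $A=\bigoplus_{x\in P}A_x$, and write elements of $A$ in the form $a=(a_x)_{x\in P}$. Define $$\mathrm{Lex}_{x\in P}I_x=\{a\in I \mid \forall x,y\in P,\ x\prec y\Rightarrow \max\sigma(a_x)\le\min\sigma(a_y)\}.$$ Then $\mathrm{Lex}_{x\in P}I_x$ is an isocone of $A$.
   Context: All $C^*$-algebras are unital and nonzero. For a $C^*$-algebra $A$ with unit $1$, $\mathrm{Re}(A)$ is the set of self-adjoint elements and $\sigma(a)$ is the spectrum of $a$. $x\prec y$ means $x\preceq y$ and $x\ne y$. $I(\mathbb{R})$ is the set of continuous non-decreasing functions $\mathbb{R}\to\mathbb{R}$. An isocone of $A$ is a subset $I\subset\mathrm{Re}(A)$ such that: (1) $x\cdot 1\in I$ for all $x\in\mathbb{R}$; (2) $b+b'\in I$ for all $b,b'\in I$; (3) $\phi(b)\in I$ for all $b\in I$ and $\phi\in I(\mathbb{R})$ (continuous functional calculus); (4) $I$ is norm-closed; (5) $\overline{I-I}=\mathrm{Re}(A)$, where $I-I=\{b-b':b,b'\in I\}$ and the bar denotes norm closure. $\bigoplus_{x\in P}I_x$ denotes the set of $(a_x)_{x\in P}$ with $a_x\in I_x$ for all $x$. *)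

(* Defs.v *)
From HB Require Import structures.
From mathcomp Require Import all_boot all_order all_algebra.
From mathcomp Require Import complex.
From mathcomp Require Import interval_inference.
From mathcomp Require Import boolp classical_sets functions reals topology.
From mathcomp Require Import normedtype.

Set Implicit Arguments.
Unset Strict Implicit.
Unset Printing Implicit Defensive.

Import Order.TTheory GRing.Theory Num.Theory.
Import numFieldNormedType.Exports.

Local Open Scope classical_set_scope.
Local Open Scope complex_scope.
Local Open Scope ring_scope.

(* The usual topology and norm of the complex numbers. *)
#[non_forgetful_inheritance]
HB.instance Definition _ (R : rcfType) := PseudoPointedMetric.copy R[i] R[i]^o.
#[non_forgetful_inheritance]
HB.instance Definition _ (R : rcfType) := NormedModule.copy R[i] R[i]^o.

(* Unital C*-algebras, the zero algebra included, so that a direct sum over an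
   empty index type is an instance; 1 != 0 is a separate hypothesis.
   - The norm of a normed module over R[i] takes its values in R[i]; they are
     nonnegative, hence real, for the order of R[i].
   - The product is part of the mixin because the library has no common
     structure of ring and normed module that is not a numDomainType; the ring
     structure, with its notations, is recovered just below. *)
HB.mixin Record isCStarAlgebra (R : realType) A
    & CompleteNormedModule R[i] A := {
  cstar_one : A ;
  cstar_mul : A -> A -> A ;
  cstar_mulA : associative cstar_mul ;
  cstar_mul1r : left_id cstar_one cstar_mul ;
  cstar_mulr1 : right_id cstar_one cstar_mul ;
  cstar_mulDl : left_distributive cstar_mul +%R ;
  cstar_mulDr : right_distributive cstar_mul +%R ;
  cstar_scalerAl : forall (k : R[i]) (a b : A),
    k *: cstar_mul a b = cstar_mul (k *: a) b ;
  cstar_scalerAr : forall (k : R[i]) (a b : A),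
    k *: cstar_mul a b = cstar_mul a (k *: b) ;
  cstar_normM : forall a b : A, `|cstar_mul a b| <= `|a| * `|b| ;
  star : A -> A ;
  starK : involutive star ;
  starD : {morph star : a b / a + b} ;
  starZ : forall (k : R[i]) (a : A), star (k *: a) = k^* *: star a ;
  starM : forall a b : A, star (cstar_mul a b) = cstar_mul (star b) (star a) ;
  cstar_normE : forall a : A, `|cstar_mul (star a) a| = `|a| ^+ 2
}.

#[short(type="cstarAlgType")]
HB.structure Definition CStarAlgebra (R : realType) :=
  {A of CompleteNormedModule R[i] A & isCStarAlgebra R A}.

HB.instance Definition _ (R : realType) (A : cstarAlgType R) :=
  GRing.Zmodule_isPzRing.Build (CStarAlgebra.sort A)
    (@cstar_mulA R A) (@cstar_mul1r R A) (@cstar_mulr1 R A)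
    (@cstar_mulDl R A) (@cstar_mulDr R A).

Section Spectrum.
Variables (R : realType) (A : cstarAlgType R).
Implicit Types (a b c : A) (z : R[i]) (f g : R[i] -> R[i]).

Definition selfadjoint : set A := [set a | star a = a].

Definition invertible a := exists b, a * b = 1 /\ b * a = 1.

Definition spectrum a : set R[i] :=
  [set z : R[i] | ~ invertible (a - z *: (1 : A))].

(* Phi is a unital *-homomorphism from C(spectrum a) to A which sends the
   inclusion of spectrum a in the complex numbers to a.  An element of
   C(spectrum a) is represented by any function R[i] -> R[i] whose restriction
   to spectrum a is continuous; calculus_ext says that the value of Phi only
   depends on this restriction. *)
Record calculus a (Phi : (R[i] -> R[i]) -> A) : Prop := {
  calculus_ext : forall f g,
    {within spectrum a, continuous f} -> {within spectrum a, continuous g} ->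
    (forall z, spectrum a z -> f z = g z) -> Phi f = Phi g ;
  calculusD : forall f g,
    {within spectrum a, continuous f} -> {within spectrum a, continuous g} ->
    Phi (fun z => f z + g z) = Phi f + Phi g ;
  calculusM : forall f g,
    {within spectrum a, continuous f} -> {within spectrum a, continuous g} ->
    Phi (fun z => f z * g z) = Phi f * Phi g ;
  calculusZ : forall (k : R[i]) f,
    {within spectrum a, continuous f} ->
    Phi (fun z => k * f z) = k *: Phi f ;
  calculus_star : forall f,
    {within spectrum a, continuous f} ->
    Phi (fun z => (f z)^*) = star (Phi f) ;
  calculus1 : Phi (fun=> 1) = 1 ;
  calculus_id : Phi id = a
}.

(* is_fcalc a phi c means c = phi(a).  For selfadjoint a there is
   exactly one such c (Gelfand duality), and spectrum a is real, so that only
   the values of phi at the points of the spectrum matter. *)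
Definition is_fcalc a (phi : R -> R) c :=
  exists2 Phi, calculus a Phi & Phi (fun z => (phi (complex.Re z))%:C) = c.

Record isocone (I : set A) : Prop := {
  isocone_selfadjoint : I `<=` selfadjoint ;
  isocone_cst : forall x : R, I (x%:C *: (1 : A)) ;
  isoconeD : forall b b', I b -> I b' -> I (b + b') ;
  isocone_fcalc : forall b (phi : R -> R), I b ->
    continuous phi -> {homo phi : x y / x <= y} ->
    exists2 c, is_fcalc b phi c & I c ;
  isocone_closed : closed I ;
  isocone_dense : closure [set b - b' | b in I & b' in I] = selfadjoint
}.

End Spectrum.
Arguments selfadjoint {R} A.

(* Greatest and least elements of a set of complex numbers, for the order of
   R[i] (z <= w iff w - z is a nonnegative real), which extends that of R.
   The default value is irrelevant for the spectrum of a selfadjoint element of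
   a nonzero C*-algebra, a nonempty compact set of reals. *)
Definition set_max (R : realType) (S : set R[i]) : R[i] :=
  xget 0 [set m | S m /\ ubound S m].
Definition set_min (R : realType) (S : set R[i]) : R[i] :=
  xget 0 [set m | S m /\ lbound S m].

(* Finite direct sum of C*-algebras: pointwise operations and sup norm. *)
Definition csum (R : realType) (P : finType) (A : P -> cstarAlgType R) : Type :=
  forall x, A x.

Section DirectSum.
Variables (R : realType) (P : finType) (A : P -> cstarAlgType R).
Local Notation S := (csum A).
Implicit Types (a b c : S) (k l : R[i]).

HB.instance Definition _ := gen_eqMixin S.
HB.instance Definition _ := gen_choiceMixin S.

Let csum_ext a b : (forall x, a x = b x) -> a = b.
Proof. exact: functional_extensionality_dep. Qed.

Let add a b : S := fun x => a x + b x.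
Let opp a : S := fun x => - a x.
Let zero : S := fun=> 0.

Let addA : associative add.
Proof. by move=> a b c; apply: csum_ext => x; exact: addrA. Qed.
Let addC : commutative add.
Proof. by move=> a b; apply: csum_ext => x; exact: addrC. Qed.
Let add0 : left_id zero add.
Proof. by move=> a; apply: csum_ext => x; exact: add0r. Qed.
Let addN : left_inverse zero opp add.
Proof. by move=> a; apply: csum_ext => x; exact: addNr. Qed.

HB.instance Definition _ := GRing.isZmodule.Build S addA addC add0 addN.

Let scale k a : S := fun x => k *: a x.

Let scaleA k l a : scale k (scale l a) = scale (k * l) a.
Proof. by apply: csum_ext => x; exact: scalerA. Qed.
Let scale1 : left_id 1 scale.
Proof. by move=> a; apply: csum_ext => x; exact: scale1r. Qed.
Let scaleDr : right_distributive scale +%R.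
Proof. by move=> k a b; apply: csum_ext => x; exact: scalerDr. Qed.
Let scaleDl a : {morph scale^~ a : k l / k + l}.
Proof. by move=> k l; apply: csum_ext => x; exact: scalerDl. Qed.

HB.instance Definition _ :=
  GRing.Zmodule_isLmodule.Build R[i] S scaleA scale1 scaleDr scaleDl.

(* The maximum is taken among the nonnegative elements of R[i], which are
   totally ordered. *)
Let sup_norm a : R[i] := (\big[Num.max/0%:nng]_x `|a x|%:nng)%:num.

Let sup_norm_ge a x : `|a x| <= sup_norm a.
Proof. by rewrite -[leLHS]nngE num_le; exact: le_bigmax. Qed.

Let sup_norm_le a k : 0 <= k -> (forall x, `|a x| <= k) -> sup_norm a <= k.
Proof.
move=> /nonnegP[{}k] ak; rewrite /sup_norm num_le.
by apply/bigmax_leP; split=> [|x _]; rewrite -num_le //=; exact: ak.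
Qed.

Let sup_norm_ge0 a : 0 <= sup_norm a.
Proof. by rewrite /sup_norm. Qed.

Let sup_normD a b : sup_norm (a + b) <= sup_norm a + sup_norm b.
Proof.
apply: sup_norm_le => [|x]; first by apply: addr_ge0; exact: sup_norm_ge0.
by apply: le_trans (ler_normD _ _) _; apply: lerD; exact: sup_norm_ge.
Qed.

Let sup_normZ k a : sup_norm (k *: a) = `|k| * sup_norm a.
Proof.
have le1 l b : sup_norm (l *: b) <= `|l| * sup_norm b.
  apply: sup_norm_le => [|x]; first by apply: mulr_ge0; [exact: normr_ge0|exact: sup_norm_ge0].
  by rewrite [(l *: b) x]/(l *: b x) normrZ ler_wpM2l ?normr_ge0 ?sup_norm_ge.
apply/eqP; rewrite eq_le le1 /=; have [->|k0] := eqVneq k 0.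
  by rewrite normr0 mul0r.
have := le1 k^-1 (k *: a); rewrite scalerA mulVf // scale1r normfV.
by rewrite ler_pdivlMl // normr_gt0.
Qed.

Let sup_norm_eq0 a : sup_norm a = 0 -> a = 0.
Proof.
move=> a0; apply: csum_ext => x; apply/eqP.
by rewrite -normr_le0 -a0; exact: sup_norm_ge.
Qed.

HB.instance Definition _ :=
  Lmodule_isNormed.Build R[i] S sup_normD sup_normZ sup_norm_eq0.

Let csum_complete (F : set_system S) : ProperFilter F -> cauchy F -> cvg F.
Proof.
move=> FF Fc.
have Fcx x : cauchy ((fun a : S => a x) @ F).
  apply/cauchy_ballP => e e0; rewrite near_map2.
  move/cauchy_ballP: Fc => /(_ e e0); apply: filterS => -[a b].
  by rewrite -!ball_normE /=; apply: le_lt_trans; exact: (sup_norm_ge (a - b)).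
pose l : S := fun x => lim ((fun a : S => a x) @ F).
have Fl x : (fun a : S => a x) @ F --> l x.
  exact: (@cauchy_cvg (A x) _ _ (Fcx x)).
apply/cvg_ex; exists l; apply/(@cvgrPdist_le _ S _ F _ id) => e e0.
have H : \forall a \near F, forall x, `|l x - a x| <= e.
  have := @filter_forall S P (fun x => [set a | `|l x - a x| <= e]) F.
  apply=> x.
  by have /cvgrPdist_le/(_ e e0) := Fl x.
apply: filterS H => a la.
by apply: sup_norm_le => //; exact: ltW.
Qed.

HB.instance Definition _ := Uniform_isComplete.Build S csum_complete.

Let one : S := fun=> 1.
Let mul a b : S := fun x => a x * b x.
Let str a : S := fun x => star (a x).

Let mulA : associative mul.
Proof. by move=> a b c; apply: csum_ext => x; exact: mulrA. Qed.
Let mul1 : left_id one mul.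
Proof. by move=> a; apply: csum_ext => x; exact: mul1r. Qed.
Let mulr1' : right_id one mul.
Proof. by move=> a; apply: csum_ext => x; exact: mulr1. Qed.
Let mulDl : left_distributive mul +%R.
Proof. by move=> a b c; apply: csum_ext => x; exact: mulrDl. Qed.
Let mulDr : right_distributive mul +%R.
Proof. by move=> a b c; apply: csum_ext => x; exact: mulrDr. Qed.
Let scaleAl k a b : k *: mul a b = mul (k *: a) b.
Proof. by apply: csum_ext => x; exact: cstar_scalerAl. Qed.
Let scaleAr k a b : k *: mul a b = mul a (k *: b).
Proof. by apply: csum_ext => x; exact: cstar_scalerAr. Qed.
Let strK : involutive str.
Proof. by move=> a; apply: csum_ext => x; exact: starK. Qed.
Let strD : {morph str : a b / a + b}.
Proof. by move=> a b; apply: csum_ext => x; exact: starD. Qed.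
Let strZ k a : str (k *: a) = k^* *: str a.
Proof. by apply: csum_ext => x; exact: starZ. Qed.
Let strM a b : str (mul a b) = mul (str b) (str a).
Proof. by apply: csum_ext => x; exact: starM. Qed.

Let normM a b : `|mul a b| <= `|a| * `|b|.
Proof.
apply: sup_norm_le => [|x]; first exact: mulr_ge0.
apply: le_trans (cstar_normM _ _) _.
by apply: ler_pM => //; exact: sup_norm_ge.
Qed.

Let normE a : `|mul (str a) a| = `|a| ^+ 2.
Proof.
apply/eqP; rewrite eq_le; apply/andP; split.
  apply: sup_norm_le => [|x]; first exact: exprn_ge0.
  rewrite [mul _ _ x]/(cstar_mul (star (a x)) (a x)) cstar_normE.
  by rewrite lerXn2r ?nnegrE //; exact: sup_norm_ge.
set N := `|mul _ _|; have N0 : 0 <= N by exact: normr_ge0.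
rewrite -[N]sqrtCK lerXn2r ?nnegrE ?sqrtC_ge0 //.
apply: sup_norm_le => [|x]; first by rewrite sqrtC_ge0.
rewrite -(@ler_pXn2r _ 2) ?nnegrE ?sqrtC_ge0 // sqrtCK -cstar_normE.
exact: sup_norm_ge (mul (str a) a) x.
Qed.

HB.instance Definition _ := isCStarAlgebra.Build R S mulA mul1 mulr1' mulDl
  mulDr scaleAl scaleAr normM strK strD strZ strM normE.

End DirectSum.

Definition csum_set (R : realType) (P : finType) (A : P -> cstarAlgType R)
    (I : forall x, set (A x)) : set (csum A) :=
  [set a | forall x, I x (a x)].

Definition Lex (R : realType) (d : Order.disp_t) (P : finPOrderType d)
    (A : P -> cstarAlgType R) (I : forall x, set (A x)) : set (csum A) :=
  [set a | csum_set I a /\ forall x y : P, (x < y)%O ->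
     set_max (spectrum (a x)) <= set_min (spectrum (a y))].

(* Main.v *)
(* Write M(a) and m(a) for the greatest and least points of sigma(a).  For a in
   an isocone and s >= ||a||, the spectrum of a + s is nonnegative, so that
   M(a) = ||a + s|| - s and likewise m(a) = s - ||a - s||.  Hence M is subadditive,
   m superadditive and both are continuous, which gives stability under sums and
   limits; stability under calculus is monotone spectral mapping.  Density:
   subtracting in I cancels scalars, so b_x and b'_x can both be shifted by a large
   multiple of the number of elements below x, which places them in Lex.

   The isocone axioms provide a *-homomorphism Phi : C(sigma(a)) -> A for a in I, and
   what is needed about norms follows from it without the spectral radius formula:
   - a real phi with |phi| <= 1 is the real part of the unimodular function
     phi + i sqrt(1 - phi^2), which Phi maps to a unitary, so ||Phi(phi)|| <= 1;
   - if r is a limit of points of sigma(a), bump functions at r give approximate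
     eigenvectors of a, so that r is in sigma(a) and |r| <= ||a||. *)

Require Import Defs.
From HB Require Import structures.
From mathcomp Require Import all_boot all_order all_algebra.
From mathcomp Require Import complex.
From mathcomp Require Import ring lra.
From mathcomp Require Import interval_inference.
From mathcomp Require Import boolp classical_sets functions reals topology.
From mathcomp Require Import normedtype realfun.

Set Implicit Arguments.
Unset Strict Implicit.
Unset Printing Implicit Defensive.

Import Order.TTheory GRing.Theory Num.Theory.
Import numFieldNormedType.Exports.

Local Open Scope classical_set_scope.
Local Open Scope complex_scope.
Local Open Scope ring_scope.

(** * Real-valued norm on a complex normed space *)

Section RealNorm.
Variables (R : realType) (V : normedModType R[i]).
Implicit Types (u v : V).

(** The norm takes values in [R[i]]. They are real, so the real part loses nothing and gives access
    to the total order of [R]. *)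
Definition rnorm u : R := complex.Re `|u|.

Lemma rnormE u : `|u| = (rnorm u)%:C.
Proof. by rewrite /rnorm RRe_real//; exact: normr_real. Qed.

Lemma rnorm_ge0 u : 0 <= rnorm u.
Proof. by rewrite -ler0c -rnormE; exact: normr_ge0. Qed.

Lemma rnormD u v : rnorm (u + v) <= rnorm u + rnorm v.
Proof. by rewrite -lecR rmorphD/= -!rnormE ler_normD. Qed.

Lemma rnormN u : rnorm (- u) = rnorm u.
Proof. by rewrite /rnorm normrN. Qed.

Lemma rnorm_triangle w u v : rnorm (u - v) <= rnorm (u - w) + rnorm (w - v).
Proof. by rewrite -[u - v](subrKA w) rnormD. Qed.

Lemma rnormZ (r : R) u : rnorm (r%:C *: u) = `|r| * rnorm u.
Proof.
apply: complexI; rewrite rmorphM/= -!rnormE normrZ; congr (_ * _).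
by rewrite normc_def /= expr0n addr0 sqrtr_sqr.
Qed.

Lemma rnorm_eq0 u : (rnorm u == 0) = (u == 0).
Proof. by rewrite -[RHS]normr_eq0 rnormE eq_complex /= eqxx andbT. Qed.

(** A positive element of [R[i]] is real, so balls of complex radius are balls of real radius. *)
Lemma closure_rnorm (S : set V) u :
  closure S u <-> forall e : R, 0 < e -> exists2 v, S v & rnorm (u - v) < e.
Proof.
split=> [clS e e0|clS B /nbhs_ballP[e /= e0 eB]].
  have e0C : 0 < e%:C by rewrite ltcR.
  have [v [Sv]] := clS _ (nbhsx_ballx u e%:C e0C).
  by rewrite -ball_normE /= rnormE ltcR; exists v.
have eE : e = (complex.Re e)%:C by rewrite RRe_real ?gtr0_real.
have [v Sv uv] : exists2 v, S v & rnorm (u - v) < complex.Re e.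
  by apply: clS; rewrite -ltcR -eE.
exists v; split=> //; apply: eB.
by rewrite -ball_normE /= rnormE eE ltcR.
Qed.

End RealNorm.

(** * Continuity of maps on the complex plane, and products of commuting elements *)

Lemma continuous_complex_lift (R : realType) (phi : R -> R) :
  continuous phi -> continuous (fun z : R[i] => (phi (complex.Re z))%:C : R[i]).
Proof.
move=> cphi z B /nbhs_ballP[e /= e0 eB].
have eE : e = (complex.Re e)%:C by rewrite RRe_real ?gtr0_real.
have re0 : 0 < complex.Re e by rewrite -ltcR -eE.
have /cvgrPdist_lt/(_ _ re0)/nbhs_ballP[d /= d0 dphi] := cphi (complex.Re z).
apply/nbhs_ballP; exists d%:C => [|w]; first by rewrite /= ltcR.
rewrite -ball_normE /= => zw; apply: eB; rewrite -ball_normE /=.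
have abs_real (r : R) : `|r%:C| = `|r|%:C.
  by rewrite normc_def /= expr0n addr0 sqrtr_sqr.
rewrite -rmorphB abs_real eE ltcR; apply: dphi; rewrite -ball_normE /=.
rewrite -ltcR; apply: le_lt_trans zw.
by have := normc_ge_Re (z - w); rewrite raddfB.
Qed.

Lemma continuous_conjc (R : realType) : continuous (fun z : R[i] => z^* : R[i]).
Proof.
move=> z B /nbhs_ballP[e /= e0 eB]; apply/nbhs_ballP; exists e => // w.
rewrite -ball_normE /= => zw; apply: eB; rewrite -ball_normE /=.
by rewrite -rmorphB norm_conjC.
Qed.

Lemma mulrBDl_comm (S : pzRingType) (x y : S) :
  x * y = y * x -> (x - y) * (x + y) = x * x - y * y.
Proof. by move=> xy; rewrite mulrBl !mulrDr xy opprD addrA addrK. Qed.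

Lemma mulrDBl_comm (S : pzRingType) (x y : S) :
  x * y = y * x -> (x + y) * (x - y) = x * x - y * y.
Proof. by move=> xy; rewrite mulrDl !mulrBr xy addrA subrK. Qed.

(** * Norm, involution and invertibility in a C*-algebra *)

Section CStarAlgebraTheory.
Variables (R : realType) (A : cstarAlgType R).
Implicit Types (a b c x y : A) (k : R[i]) (r s : R).

Lemma cstar_scaleAl k a b : k *: a * b = k *: (a * b).
Proof. exact/esym/cstar_scalerAl. Qed.

Lemma cstar_scaleAr k a b : a * (k *: b) = k *: (a * b).
Proof. exact/esym/cstar_scalerAr. Qed.

Lemma star_mul a b : star (a * b) = star b * star a.
Proof. exact: starM. Qed.

Lemma star1 : star (1 : A) = 1.
Proof.
rewrite -[LHS]mulr1 -{2}(starK (1 : A)).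
by rewrite -star_mul mulr1 starK.
Qed.

Lemma star0 : star (0 : A) = 0.
Proof. by apply: (addrI (star 0)); rewrite -starD !addr0. Qed.

Lemma starB a b : star (a - b) = star a - star b.
Proof.
by rewrite starD; congr (_ + _); apply: (addIr (star b)); rewrite -starD !addNr star0.
Qed.

Lemma rnormM a b : rnorm (a * b) <= rnorm a * rnorm b.
Proof. by rewrite -lecR rmorphM/= -!rnormE; exact: cstar_normM. Qed.

Lemma rnorm_starM a : rnorm (star a * a) = rnorm a ^+ 2.
Proof. by apply: complexI; rewrite rmorphXn/= -!rnormE; exact: cstar_normE. Qed.

(** From ||b||^2 = ||b^* b|| <= ||b^*|| ||b|| one gets ||b|| <= ||b^*||; apply this to [a] and to
    [star a]. *)
Lemma rnorm_star a : rnorm (star a) = rnorm a.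
Proof.
have le_star b : rnorm b <= rnorm (star b).
  have [->|b0] := eqVneq b 0; first by rewrite star0.
  have b1 : 0 < rnorm b by rewrite lt_def rnorm_ge0 rnorm_eq0 b0.
  by rewrite -(ler_pM2r b1) -expr2 -rnorm_starM rnormM.
by apply/eqP; rewrite eq_le le_star -{2}(starK a) le_star.
Qed.

Lemma rnorm1 : (1 : A) != 0 -> rnorm (1 : A) = 1.
Proof.
move=> A1; have n1 : rnorm (1 : A) != 0 by rewrite rnorm_eq0.
by apply: (mulfI n1); rewrite mulr1 -expr2 -rnorm_starM star1 mulr1.
Qed.

Lemma invertible_lr a b c : a * b = 1 -> c * a = 1 -> invertible a.
Proof.
move=> ab ca; exists b; split=> //.
suff -> : b = c by [].
by rewrite -[b]mul1r -ca -mulrA ab mulr1.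
Qed.

(** If c inverts ab = ba, then bc is a right inverse of a and cb a left one. *)
Lemma invertible_factor a b : a * b = b * a -> invertible (a * b) -> invertible a.
Proof.
move=> ab [c [abc cab]]; apply: (@invertible_lr _ (b * c) (c * b)).
  by rewrite mulrA.
by rewrite -mulrA -ab.
Qed.

(** * Norm and spectrum through the calculus of one self-adjoint element *)

Section Calculus.
Variables (a : A) (Phi : (R[i] -> R[i]) -> A).
Hypotheses (A1 : (1 : A) != 0) (a_sa : star a = a) (aPhi : calculus a Phi).
Implicit Types phi psi : R -> R.

Definition rcalc phi : A := Phi (fun z => (phi (complex.Re z))%:C).

Let liftc phi : continuous phi ->
  {within spectrum a, continuous (fun z => (phi (complex.Re z))%:C : R[i])}.
Proof. by move=> cphi; apply: continuous_subspaceT; exact: continuous_complex_lift. Qed.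

Lemma rcalc_ext phi psi : continuous phi -> continuous psi ->
  (forall z, spectrum a z -> phi (complex.Re z) = psi (complex.Re z)) ->
  rcalc phi = rcalc psi.
Proof.
move=> cphi cpsi e; apply: (calculus_ext aPhi); [exact: liftc|exact: liftc|].
by move=> z /e ->.
Qed.

Lemma rcalcD phi psi : continuous phi -> continuous psi ->
  rcalc (fun t => phi t + psi t) = rcalc phi + rcalc psi.
Proof.
move=> cphi cpsi; rewrite -(calculusD aPhi); try exact: liftc.
by congr Phi; apply/funext => z; rewrite rmorphD.
Qed.

Lemma rcalcM phi psi : continuous phi -> continuous psi ->
  rcalc (fun t => phi t * psi t) = rcalc phi * rcalc psi.
Proof.
move=> cphi cpsi; rewrite -(calculusM aPhi); try exact: liftc.
by congr Phi; apply/funext => z; rewrite rmorphM.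
Qed.

Lemma rcalcZ r phi : continuous phi ->
  rcalc (fun t => r * phi t) = r%:C *: rcalc phi.
Proof.
move=> cphi; rewrite -(calculusZ aPhi); try exact: liftc.
by congr Phi; apply/funext => z; rewrite rmorphM.
Qed.

Lemma rcalc_star phi : continuous phi -> star (rcalc phi) = rcalc phi.
Proof.
move=> cphi; rewrite -(calculus_star aPhi); try exact: liftc.
by congr Phi; apply/funext => z; exact: conjc_real.
Qed.

Lemma rcalc1 : rcalc (fun=> 1) = 1.
Proof. by rewrite -(calculus1 aPhi). Qed.

Lemma rcalc_cst r : rcalc (fun=> r) = r%:C *: (1 : A).
Proof.
rewrite -rcalc1 -rcalcZ; last exact: cst_continuous.
by congr rcalc; apply/funext => t; rewrite mulr1.
Qed.

Lemma rcalc_id : rcalc id = a.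
Proof.
have cid : {within spectrum a, continuous (id : R[i] -> R[i])}.
  by apply: continuous_subspaceT => z; exact: cvg_id.
have cconj : {within spectrum a, continuous (fun z : R[i] => z^* : R[i])}.
  by apply: continuous_subspaceT => z; exact: continuous_conjc.
have cD : {within spectrum a, continuous (fun z : R[i] => z + z^* : R[i])}.
  by move=> z; apply: cvgD; [exact: cid|exact: cconj].
transitivity (Phi (fun z => 2^-1 * (z + z^*))).
  congr Phi; apply/funext => z; rewrite /= (ReJ_add z) mulrC; congr (_ * _).
rewrite (@calculusZ _ _ _ _ aPhi _ _ cD) (@calculusD _ _ _ _ aPhi _ _ cid cconj).
rewrite (@calculus_star _ _ _ _ aPhi _ cid) (calculus_id aPhi) a_sa.
by rewrite -mulr2n -[a *+ 2]scaler_nat scalerA mulVf ?scale1r // pnatr_eq0.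
Qed.

Lemma rcalcBcst r : rcalc (fun t => t - r) = a - r%:C *: (1 : A).
Proof.
rewrite rcalcD ?rcalc_id ?rcalc_cst; last exact: cst_continuous; last first.
  by move=> ?; exact: cvg_id.
by rewrite rmorphN scaleNr.
Qed.

(** The reciprocal must be continuous on all of [R], hence the condition at every [t]. Later uses
    first change a function off the spectrum, or add a square, to meet it. *)
Lemma rcalc_invertible phi : continuous phi -> (forall t, phi t != 0) ->
  invertible (rcalc phi).
Proof.
move=> cphi phi0.
have cV : continuous (fun t => (phi t)^-1).
  by move=> t; apply: cvgV; [exact: phi0|exact: cphi].
exists (rcalc (fun t => (phi t)^-1)); rewrite -!rcalcM // -rcalc1.
by split; congr rcalc; apply/funext => t; rewrite ?mulfV ?mulVf.
Qed.

Let continuousB r : continuous (fun t : R => t - r).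
Proof. by move=> t; apply: cvgB; [exact: cvg_id|exact: cvg_cst]. Qed.

Lemma spectrum_real z : spectrum a z -> z = (complex.Re z)%:C.
Proof.
move=> az; have [y0|y0] := eqVneq (complex.Im z) 0.
  by case: z y0 {az} => x y /= ->.
case: az; set r := complex.Re z; set y := complex.Im z in y0.
pose c := a - r%:C *: (1 : A); pose w := ('i%C * y%:C) *: (1 : A).
have -> : a - z *: (1 : A) = c - w.
  by rewrite [z]complexE scalerDl opprD addrA.
have cwC : c * w = w * c by rewrite cstar_scaleAr cstar_scaleAl mulr1 mul1r.
have cw : (c - w) * (c + w) = c * c + (y ^+ 2)%:C *: (1 : A).
  rewrite (mulrBDl_comm cwC) cstar_scaleAl mul1r scalerA -scaleNr.
  by congr (_ + _ *: _); rewrite mulrACA -!expr2 sqr_i mulN1r opprK rmorphXn.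
have wc : (c + w) * (c - w) = (c - w) * (c + w).
  by rewrite (mulrBDl_comm cwC) (mulrDBl_comm cwC).
apply: (invertible_factor (esym wc)); rewrite cw.
have -> : c * c + (y ^+ 2)%:C *: (1 : A) = rcalc (fun t => (t - r) * (t - r) + y ^+ 2).
  rewrite rcalcD ?rcalc_cst ?rcalcM ?rcalcBcst //.
    by move=> t; apply: cvgM; exact: continuousB.
  exact: cst_continuous.
apply: rcalc_invertible.
  move=> t; apply: cvgD; last exact: cvg_cst.
  by apply: cvgM; exact: continuousB.
move=> t; rewrite gt_eqF // ltr_wpDl //; first by rewrite -expr2 sqr_ge0.
by rewrite exprn_even_gt0.
Qed.

Lemma rcalc_norm_le1 phi : continuous phi ->
  (forall z, spectrum a z -> `|phi (complex.Re z)| <= 1) -> rnorm (rcalc phi) <= 1.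
Proof.
move=> cphi phi1.
have cphi2 : continuous (fun t => phi t * phi t) by move=> t; apply: cvgM; exact: cphi.
(* Where |phi| > 1 the square root takes the default value 0. Thus [g] is continuous everywhere, and
   the identity phi^2 + g^2 = 1 is only claimed on the spectrum. *)
pose g t := Num.sqrt (1 - phi t * phi t).
have cg : continuous g.
  move=> t; apply: continuous_comp; last exact: sqrt_continuous.
  by apply: cvgB; [exact: cvg_cst|exact: cphi2].
set u := rcalc phi; pose v := rcalc g; pose w : A := 'i%C *: v.
have uw : u * w = w * u.
  rewrite cstar_scaleAl cstar_scaleAr -!rcalcM //.
  by congr (_ *: rcalc _); apply/funext => t; rewrite mulrC.
have star_uw : star (u + w) = u - w.
  by rewrite starD rcalc_star // starZ rcalc_star // -scaleNr; congr (_ + _ *: _);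
    apply/eqP; rewrite eq_complex /= oppr0 !eqxx.
have nuw : rnorm (u + w) = 1.
  apply/eqP; rewrite -(@eqrXn2 _ 2) ?rnorm_ge0 // -rnorm_starM star_uw.
  rewrite (mulrBDl_comm uw) cstar_scaleAl cstar_scaleAr scalerA.
  rewrite -['i%C * 'i%C]expr2 sqr_i scaleN1r opprK.
  rewrite -!rcalcM // -rcalcD //; last by move=> t; apply: cvgM; exact: cg.
  rewrite expr1n -(rnorm1 A1) -rcalc1; apply/eqP; congr rnorm; apply: rcalc_ext.
  - by move=> t; apply: cvgD; [exact: cphi2|apply: cvgM; exact: cg].
  - exact: cst_continuous.
  move=> z /phi1 p1; rewrite -[g _ * _]expr2 sqr_sqrtr; first by rewrite addrC subrK.
  by rewrite subr_ge0 -expr2 -real_normK ?num_real // expr_le1.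
have : rnorm (2%:R%:C *: u) <= 2.
  rewrite rmorph_nat scaler_nat mulr2n.
  have -> : u + u = (u + w) + star (u + w) by rewrite star_uw addrACA subrr addr0.
  by apply: le_trans (rnormD _ _) _; rewrite rnorm_star nuw.
by rewrite rnormZ ger0_norm // ger_pMr.
Qed.

Lemma rcalc_norm_le r phi : 0 < r -> continuous phi ->
  (forall z, spectrum a z -> `|phi (complex.Re z)| <= r) -> rnorm (rcalc phi) <= r.
Proof.
move=> r0 cphi phir.
have cphir : continuous (fun t => r^-1 * phi t).
  by move=> t; apply: cvgM; [exact: cvg_cst|exact: cphi].
have := rcalc_norm_le1 cphir; rewrite rcalcZ // rnormZ ger0_norm ?invr_ge0 ?(ltW r0) //.
rewrite ler_pdivrMl // mulr1; apply=> z /phir phiz.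
by rewrite normrM ger0_norm ?invr_ge0 ?(ltW r0) // ler_pdivrMl // mulr1.
Qed.

(** With r = Re z, if phi(a) = 0 then (a - r)^2 is the value at a of (t - r)^2 + phi(t)^2. This
    function never vanishes when phi(r) != 0, so a - r would be invertible. *)
Lemma rcalc_neq0 phi z : continuous phi -> spectrum a z ->
  phi (complex.Re z) != 0 -> rcalc phi != 0.
Proof.
move=> cphi az phiz; apply/eqP => phi0; set r := complex.Re z in phiz.
have cphi2 : continuous (fun t => phi t * phi t) by move=> t; apply: cvgM; exact: cphi.
have cr2 : continuous (fun t => (t - r) * (t - r)).
  by move=> t; apply: cvgM; exact: continuousB.
apply: (az); rewrite (spectrum_real az) -/r -rcalcBcst.
apply: (@invertible_factor _ (rcalc (fun t => t - r))) => //.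
rewrite -[_ * _]addr0 -[0](mul0r (0 : A)) -phi0 -!rcalcM // -rcalcD //.
apply: rcalc_invertible => [t|t].
  by apply: cvgD; [exact: cr2|exact: cphi2].
rewrite -!expr2 paddr_eq0 ?sqr_ge0 // !sqrf_eq0 subr_eq0.
by have [->|] := eqVneq t r.
Qed.

Lemma approx_eigenvector r : 
  (forall e, 0 < e -> exists2 z, spectrum a z & `|complex.Re z - r| < e) ->
  forall e, 0 < e ->
  exists2 w : A, w != 0 & rnorm ((a - r%:C *: (1 : A)) * w) <= e * rnorm w.
Proof.
move=> lim_r e e0.
(* [h] is a bump supported in |t - r| <= e, and [k] is t - r clipped to [-e, e]. They satisfy (t -
   r) h = k h, and k(a) has norm at most e although a - r need not. *)
pose h t := Num.max 0 (e - `|t - r|); pose k t := Num.max (- e) (Num.min e (t - r)).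
have ch : continuous h.
  move=> t; apply: (@continuous_max _ _ (fun=> 0) (fun t => e - `|t - r|)).
    exact: cvg_cst.
  by apply: cvgB; [exact: cvg_cst|apply: cvg_norm; exact: continuousB].
have ck : continuous k.
  move=> t; apply: (@continuous_max _ _ (fun=> - e) (fun t => Num.min e (t - r))).
    exact: cvg_cst.
  apply: (@continuous_min _ _ (fun=> e) (fun t => t - r)); first exact: cvg_cst.
  exact: continuousB.
have [z az zr] := lim_r e e0.
exists (rcalc h).
  by apply: (rcalc_neq0 ch az); rewrite gt_eqF // lt_max subr_gt0 zr orbT.
rewrite -rcalcBcst -rcalcM //.
have -> : (fun t => (t - r) * h t) = (fun t => k t * h t).
  apply/funext => t; rewrite /h /k.
  have [ter|ter] := ltP `|t - r| e.
    move: ter; rewrite ltr_norml => /andP[/ltW/max_idPr te /ltW/min_idPr ->].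
    by rewrite te.
  by rewrite max_l ?subr_le0 // !mulr0.
rewrite rcalcM //; apply: le_trans (rnormM _ _) _.
apply: ler_wpM2r; first exact: rnorm_ge0.
apply: rcalc_norm_le => // t _; rewrite ler_norml /k le_max lexx /= ge_max ge_min lexx.
by rewrite andbT ge0_cp // ltW.
Qed.

(** A left inverse b of a - r gives ||w|| <= ||b|| ||(a - r) w||, which an approximate eigenvector
    of precision 1 / (||b|| + 1) contradicts. *)
Lemma spectrum_limit r :
  (forall e, 0 < e -> exists2 z, spectrum a z & `|complex.Re z - r| < e) ->
  spectrum a r%:C.
Proof.
move=> /approx_eigenvector lim_r [b [_ ba1]].
have b0 : 0 < rnorm b + 1 by rewrite ltr_wpDl // rnorm_ge0.
have [|w w0 bw] := lim_r (rnorm b + 1)^-1; first by rewrite invr_gt0.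
have nw : 0 < rnorm w by rewrite lt_def rnorm_ge0 rnorm_eq0 w0.
have : rnorm w <= rnorm b * ((rnorm b + 1)^-1 * rnorm w).
  rewrite -{1}[w]mul1r -ba1 -mulrA; apply: le_trans (rnormM _ _) _.
  by apply: ler_wpM2l bw; exact: rnorm_ge0.
by rewrite mulrA ler_pMl // ler_pdivlMr // mul1r gerDl ler10.
Qed.

(** For an approximate eigenvector w at r, |r| ||w|| <= ||(a - r) w|| + ||a w|| <= (e + ||a||)
    ||w||. *)
Lemma spectrum_le_rnorm r : spectrum a r%:C -> `|r| <= rnorm a.
Proof.
move=> ar; apply/ler_addgt0Pr => e e0.
have [|w w0 aw] := @approx_eigenvector r _ e e0.
  by move=> d d0; exists r%:C; rewrite //= subrr normr0.
have nw : 0 < rnorm w by rewrite lt_def rnorm_ge0 rnorm_eq0 w0.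
rewrite -(ler_pM2r nw) -rnormZ -[_ *: w]opprK rnormN.
have -> : - (r%:C *: w) = (a - r%:C *: (1 : A)) * w - a * w.
  by rewrite mulrBl cstar_scaleAl mul1r addrC addrA addNr add0r.
apply: le_trans (rnormD _ _) _; rewrite rnormN [leRHS]mulrDl [leLHS]addrC.
by apply: lerD => //; exact: rnormM.
Qed.

(** Otherwise the spectrum, which contains its limit points, keeps away from both ||a|| and -||a||.
    Then |t| <= m < ||a|| on it, and the norm bound for the identity function gives ||a|| <= m. In
    particular the spectrum is nonempty. *)
Lemma spectrum_rnorm : exists2 r, spectrum a r%:C & `|r| = rnorm a.
Proof.
have [a0|a0] := eqVneq a 0.
  exists 0; last by rewrite a0 normr0; apply/eqP; rewrite eq_sym rnorm_eq0.
  rewrite a0 => -[b [+ _]]; rewrite scale0r subr0 mul0r => /esym/eqP.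
  by rewrite (negPf A1).
apply: contrapT => nex.
have gap r : `|r| = rnorm a ->
    exists2 e, 0 < e & forall z, spectrum a z -> e <= `|complex.Re z - r|.
  move=> ra; apply: contrapT => gap; apply: nex; exists r => //.
  apply: spectrum_limit => e e0; apply: contrapT => nz; apply: gap; exists e => // z az.
  by rewrite leNgt; apply/negP => ze; apply: nz; exists z.
have N0 : 0 < rnorm a by rewrite lt_def rnorm_ge0 rnorm_eq0 a0.
have [|e e0 He] := gap (rnorm a); first by rewrite gtr0_norm.
have [|f f0 Hf] := gap (- rnorm a); first by rewrite normrN gtr0_norm.
(* The term ||a|| / 2 keeps [m] positive, as [rcalc_norm_le] requires. *)
pose m := Num.max (rnorm a / 2) (Num.max (rnorm a - e) (rnorm a - f)).
have mN : m < rnorm a by rewrite !gt_max; apply/and3P; split; lra.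
have m0 : 0 < m by rewrite lt_max divr_gt0.
move: mN; rewrite ltNge => /negP; apply.
rewrite -{1}(rcalc_id); apply: rcalc_norm_le => // [t|z az]; first exact: cvg_id.
have ar : spectrum a (complex.Re z)%:C by rewrite -spectrum_real.
have := He z az; have := Hf z az; have := spectrum_le_rnorm ar; set x := complex.Re z.
rewrite !le_max => xN xf xe.
suff : `|x| <= rnorm a - e \/ `|x| <= rnorm a - f by case=> ->; rewrite ?orbT.
by case: (lerP 0 x) => x0; [left|right];
  move: xN xf xe; rewrite !(ler_norml, ler_normr); lra.
Qed.

(** Replacing t by min(t, m) changes nothing on the spectrum and makes phi at most phi(m)
    everywhere. For r > phi(m) the difference with r then vanishes nowhere, so it yields an
    invertible element. *)
Lemma spectrum_rcalc_le phi r m : continuous phi -> {homo phi : t u / t <= u} ->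
  (forall z, spectrum a z -> complex.Re z <= m) ->
  spectrum (rcalc phi) r%:C -> r <= phi m.
Proof.
move=> cphi hphi am phir; rewrite leNgt; apply/negP => mr; apply: phir.
have cmin : continuous (fun t => phi (Num.min t m)).
  move=> t; apply: (@continuous_comp _ _ _ (fun t => Num.min t m)); last exact: cphi.
  by apply: (@continuous_min _ _ id (fun=> m)); [exact: cvg_id|exact: cvg_cst].
rewrite (@rcalc_ext _ (fun t => phi (Num.min t m))) // => [|z /am /min_idPl ->//].
rewrite -rcalc_cst -scaleN1r -[-1](rmorphN1 (real_complex R)).
rewrite -rcalcZ; last exact: cst_continuous.
rewrite -rcalcD //; last exact: cst_continuous.
apply: rcalc_invertible => [t|t]; first by apply: cvgD; [exact: cmin|exact: cvg_cst].
rewrite mulN1r subr_eq0 lt_eqF //; apply: le_lt_trans mr.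
by apply: hphi; rewrite ge_min lexx orbT.
Qed.

Lemma spectrum_rcalc_ge phi r m : continuous phi -> {homo phi : t u / t <= u} ->
  (forall z, spectrum a z -> m <= complex.Re z) ->
  spectrum (rcalc phi) r%:C -> phi m <= r.
Proof.
move=> cphi hphi am phir; rewrite leNgt; apply/negP => rm; apply: phir.
have cmax : continuous (fun t => phi (Num.max t m)).
  move=> t; apply: (@continuous_comp _ _ _ (fun t => Num.max t m)); last exact: cphi.
  by apply: (@continuous_max _ _ id (fun=> m)); [exact: cvg_id|exact: cvg_cst].
rewrite (@rcalc_ext _ (fun t => phi (Num.max t m))) // => [|z /am /max_idPl ->//].
rewrite -rcalc_cst -scaleN1r -[-1](rmorphN1 (real_complex R)).
rewrite -rcalcZ; last exact: cst_continuous.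
rewrite -rcalcD //; last exact: cst_continuous.
apply: rcalc_invertible => [t|t]; first by apply: cvgD; [exact: cmax|exact: cvg_cst].
rewrite mulN1r subr_eq0 gt_eqF //; apply: (lt_le_trans rm).
by apply: hphi; rewrite le_max lexx orbT.
Qed.

End Calculus.

Lemma spectrumD_scalar a k z :
  spectrum (a + k *: (1 : A)) z <-> spectrum a (z - k).
Proof. by rewrite /spectrum /= scalerBl opprB addrA. Qed.

Lemma spectrum_scalar k z : spectrum (k *: (1 : A)) z -> z = k.
Proof.
move=> kz; apply: contrapT => /eqP zk; apply: kz; rewrite -scalerBl.
have kz0 : k - z != 0 by rewrite subr_eq0 eq_sym.
exists ((k - z)^-1 *: (1 : A)).
by rewrite !cstar_scaleAl !mul1r !scalerA mulfV // mulVf // scale1r.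
Qed.

End CStarAlgebraTheory.

(** * Extreme points of the spectrum of an element of an isocone *)

Lemma set_max_eq (R : realType) (S : set R[i]) m :
  S m -> ubound S m -> set_max S = m.
Proof.
move=> Sm um; rewrite /set_max; case: xgetP => [y _ [Sy uy]|/(_ m)[]//].
by apply/eqP; rewrite eq_le um //= uy.
Qed.

Lemma set_min_eq (R : realType) (S : set R[i]) m :
  S m -> lbound S m -> set_min S = m.
Proof.
move=> Sm lm; rewrite /set_min; case: xgetP => [y _ [Sy ly]|/(_ m)[]//].
by apply/eqP; rewrite eq_le lm //= ly.
Qed.

Section IsoconeTheory.
Variables (R : realType) (A : cstarAlgType R) (I : set A).
Hypotheses (A1 : (1 : A) != 0) (I_isocone : isocone I).
Implicit Types (a b c : A) (r s m : R).

Lemma isocone_calculus a : I a -> exists Phi, calculus a Phi.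
Proof.
move=> Ia; have [|//|_ [Phi aPhi _] _] := isocone_fcalc I_isocone (phi := id) Ia.
  by move=> t; exact: cvg_id.
by exists Phi.
Qed.

Lemma isocone_star a : I a -> star a = a.
Proof. exact: (isocone_selfadjoint I_isocone). Qed.

Lemma isoconeD_scalar a r : I a -> I (a + r%:C *: (1 : A)).
Proof.
by move=> Ia; apply: (isoconeD I_isocone) => //; exact: (isocone_cst I_isocone).
Qed.

Lemma isocone_spectrum_real a z : I a -> spectrum a z -> z = (complex.Re z)%:C.
Proof.
move=> Ia; have [Phi aPhi] := isocone_calculus Ia.
exact: (spectrum_real (isocone_star Ia) aPhi).
Qed.

Lemma isocone_spectrum_le a r : I a -> spectrum a r%:C -> `|r| <= rnorm a.
Proof.
move=> Ia; have [Phi aPhi] := isocone_calculus Ia.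
exact: (spectrum_le_rnorm A1 (isocone_star Ia) aPhi).
Qed.

Lemma isocone_spectrum_rnorm a : I a ->
  exists2 r, spectrum a r%:C & `|r| = rnorm a.
Proof.
move=> Ia; have [Phi aPhi] := isocone_calculus Ia.
exact: (spectrum_rnorm A1 (isocone_star Ia) aPhi).
Qed.

(** The bound [s] is left free so that elements to be compared can share one shift. *)
Lemma isocone_max a s (m := rnorm (a + s%:C *: (1 : A)) - s) : I a -> rnorm a <= s ->
  [/\ spectrum a m%:C, forall z, spectrum a z -> complex.Re z <= m
    & set_max (spectrum a) = m%:C].
Proof.
move=> Ia les; have Ias := isoconeD_scalar s Ia.
have am : spectrum a m%:C.
  have [r asr rN] := isocone_spectrum_rnorm Ias.
  have ar : spectrum a (r - s)%:C by rewrite rmorphB; exact/spectrumD_scalar.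
  (* As r - s lies in the spectrum of [a], it is at least -s; hence r >= 0 and |r| = r. *)
  have := le_trans (isocone_spectrum_le Ia ar) les.
  by rewrite ler_norml /m -rN => /andP[rs _]; rewrite ger0_norm //; lra.
have um z : spectrum a z -> complex.Re z <= m.
  move=> az; rewrite lerBrDr; apply: le_trans (ler_norm _) _.
  apply: isocone_spectrum_le => //; apply/spectrumD_scalar.
  by rewrite rmorphD /= addrK -(isocone_spectrum_real Ia az).
split=> //; apply: set_max_eq => // z az.
by rewrite (isocone_spectrum_real Ia az) lecR um.
Qed.

Lemma isocone_min a s (m := s - rnorm (a - s%:C *: (1 : A))) : I a -> rnorm a <= s ->
  [/\ spectrum a m%:C, forall z, spectrum a z -> m <= complex.Re z
    & set_min (spectrum a) = m%:C].
Proof.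
move=> Ia les; have aNs : a - s%:C *: (1 : A) = a + (- s)%:C *: (1 : A).
  by rewrite rmorphN scaleNr.
have Ias := isoconeD_scalar (- s) Ia; rewrite -aNs in Ias.
have am : spectrum a m%:C.
  have [r asr rN] := isocone_spectrum_rnorm Ias.
  have ar : spectrum a (r + s)%:C.
    by rewrite aNs in asr; move/spectrumD_scalar: asr; rewrite -rmorphB opprK.
  have := le_trans (isocone_spectrum_le Ia ar) les.
  rewrite ler_norml /m -rN => /andP[_ rs]; rewrite ler0_norm; last lra.
  by rewrite opprK addrC.
have lm z : spectrum a z -> m <= complex.Re z.
  move=> az; rewrite lerBlDr -lerBlDl; apply: le_trans (ler_norm _) _.
  rewrite distrC; apply: isocone_spectrum_le => //; rewrite aNs; apply/spectrumD_scalar.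
  by rewrite -rmorphB opprK subrK /= -(isocone_spectrum_real Ia az).
split=> //; apply: set_min_eq => // z az.
by rewrite (isocone_spectrum_real Ia az) lecR lm.
Qed.

End IsoconeTheory.

(** * Comparing the spectra of elements of two isocones *)

Section IsoconePair.
Variables (R : realType) (A B : cstarAlgType R) (I : set A) (J : set B).
Hypotheses (A1 : (1 : A) != 0) (B1 : (1 : B) != 0).
Hypotheses (I_isocone : isocone I) (J_isocone : isocone J).

(** Turns the order condition into a norm inequality, whose left side is subadditive and continuous;
    this serves sums and limits. *)
Lemma set_max_le_minE a b s : I a -> J b -> rnorm a <= s -> rnorm b <= s ->
  (set_max (spectrum a) <= set_min (spectrum b)) =
  (rnorm (a + s%:C *: (1 : A)) + rnorm (b - s%:C *: (1 : B)) <= s + s).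
Proof.
move=> Ia Jb les bs.
have [_ _ ->] := isocone_max A1 I_isocone Ia les.
have [_ _ ->] := isocone_min B1 J_isocone Jb bs.
by rewrite lecR lerBlDr addrAC lerBrDr.
Qed.

(** Both extremes are attained. This form serves scalars, shifts and the calculus. *)
Lemma set_max_le_minP a b : I a -> J b ->
  (set_max (spectrum a) <= set_min (spectrum b)) <->
  forall r r', spectrum a r%:C -> spectrum b r'%:C -> r <= r'.
Proof.
move=> Ia Jb.
have [am um ->] := isocone_max A1 I_isocone Ia (lexx _).
have [bm lm ->] := isocone_min B1 J_isocone Jb (lexx _).
rewrite lecR; split=> [mm r r' /um ar /lm br|]; last exact.
exact: le_trans ar (le_trans mm br).
Qed.

(** Two inequalities of spectral mapping suffice: max sigma(phi(a)) <= phi(max sigma(a)) <= phi(min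
    sigma(b)) <= min sigma(phi(b)). *)
Lemma is_fcalc_max_le_min a b a' b' phi : I a -> J b -> I a' -> J b' ->
  continuous phi -> {homo phi : t u / t <= u} ->
  is_fcalc a phi a' -> is_fcalc b phi b' ->
  set_max (spectrum a) <= set_min (spectrum b) ->
  set_max (spectrum a') <= set_min (spectrum b').
Proof.
move=> Ia Jb Ia' Jb' cphi hphi [Phi aPhi a'E] [Psi bPsi b'E] ab.
have [_ um maxE] := isocone_max A1 I_isocone Ia (lexx _).
have [_ lm minE] := isocone_min B1 J_isocone Jb (lexx _).
apply/set_max_le_minP => // r r'; rewrite -a'E -b'E.
move=> /(spectrum_rcalc_le aPhi cphi hphi um) ar.
move=> /(spectrum_rcalc_ge bPsi cphi hphi lm) br.
apply: le_trans ar (le_trans _ br); apply: hphi.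
by rewrite -lecR -maxE -minE.
Qed.

End IsoconePair.

(** * Norm, spectrum and calculus in a finite direct sum *)

Section DirectSumTheory.
Variables (R : realType) (P : finType) (A : P -> cstarAlgType R).
Implicit Types (a b : csum A).

Lemma csum_normE a : `|a| = (\big[Num.max/0%:nng]_x `|a x|%:nng)%:num.
Proof. by []. Qed.

Lemma rnorm_csum_ge a x : rnorm (a x) <= rnorm a.
Proof.
rewrite -lecR -!rnormE csum_normE -[leLHS]nngE num_le; exact: le_bigmax.
Qed.

Lemma rnorm_csum_lt a e : 0 < e -> (forall x, rnorm (a x) < e) -> rnorm a < e.
Proof.
move=> e0 ae; rewrite -ltcR -rnormE csum_normE.
have e0C : 0 <= e%:C by rewrite ler0c ltW.
(* The maximum is taken among nonnegative elements, so the bound is repackaged as one. Its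
   positivity covers the default 0, the value over an empty index type. *)
rewrite -[ltRHS]/((NngNum e0C)%:num) num_lt.
apply/bigmax_ltP; split=> [|x _]; rewrite -num_lt /= ?rnormE ltcR //.
Qed.

Lemma csum_spectrum a x z : spectrum (a x) z -> spectrum a z.
Proof.
move=> axz [b [ab ba]]; apply: axz; exists (b x); split.
  exact: (congr1 (fun c : csum A => c x) ab).
exact: (congr1 (fun c : csum A => c x) ba).
Qed.

(** The calculi of the components are applied side by side. The spectrum of [a] contains that of
    each component, so continuity on the former restricts to the latter. *)
Lemma csum_is_fcalc a phi (c : csum A) :
  (forall x, is_fcalc (a x) phi (c x)) -> is_fcalc a phi c.
Proof.
move=> ac.
have acx x : exists F,
    calculus (a x) F /\ F (fun z => (phi (complex.Re z))%:C) = c x.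
  by have [F] := ac x; exists F.
pose Phi x := sval (cid (acx x)).
have PhiP x : calculus (a x) (Phi x) /\ Phi x (fun z => (phi (complex.Re z))%:C) = c x.
  exact: svalP (cid (acx x)).
have res x (f : R[i] -> R[i]) : {within spectrum a, continuous f} ->
    {within spectrum (a x), continuous f}.
  apply: (@continuous_subspaceW _ _ (spectrum (a x)) (spectrum a) f) => z.
  exact: csum_spectrum.
exists (fun f x => Phi x f); last first.
  by apply: functional_extensionality_dep => x; have [] := PhiP x.
split=> [f g /res cf /res cg fg|f g /res cf /res cg
  |f g /res cf /res cg|k f /res cf|f /res cf| |];
  apply: functional_extensionality_dep => x; have [Fx _] := PhiP x.
- by apply: (calculus_ext Fx) => // z /csum_spectrum; exact: fg.
- exact: (calculusD Fx).
- exact: (calculusM Fx).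
- exact: (calculusZ Fx).
- exact: (calculus_star Fx).
- exact: (calculus1 Fx).
- exact: (calculus_id Fx).
Qed.

End DirectSumTheory.

(** * Closedness of the self-adjoint part, then the isocone axioms for the lexicographic sum *)

(** The involution is isometric, so ||a^* - a|| <= 2 ||a - b|| for every self-adjoint b. *)
Lemma closed_selfadjoint (R : realType) (A : cstarAlgType R) :
  closed (selfadjoint A).
Proof.
move=> a /closure_rnorm cla; apply/eqP; rewrite -subr_eq0 -rnorm_eq0.
rewrite eq_le rnorm_ge0 andbT; apply/ler_addgt0Pr => e e0.
have [|b bsa ab] := cla (e / 2); first by rewrite divr_gt0.
apply: le_trans (rnorm_triangle b _ _) _; rewrite add0r -{1}bsa.
rewrite -starB rnorm_star -(rnormN (b - a)) opprB; lra.
Qed.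

Theorem theorem5 (R : realType) (d : Order.disp_t) (P : finPOrderType d)
    (A : P -> cstarAlgType R) (I : forall x : P, set (A x))
    (A_neq0 : forall x : P, (1 : A x) != 0)
    (I_isocone : forall x : P, isocone (I x)) :
  isocone (Lex I).
Proof.
(* Each spectrum of [b x] lies in [-s, s], an interval of length s + s; shifts that differ by at
   least this length along the order separate them. *)
have Lex_shift (b : csum A) (s : R) : csum_set I b -> rnorm b <= s ->
    Lex I (fun x => b x + (#|[pred y | (y < x)%O]|%:R * (s + s))%:C *: (1 : A x)).
  move=> Ib bs; split=> [x|x y xy]; first exact: isoconeD_scalar.
  apply/(set_max_le_minP (A_neq0 x) (A_neq0 y) (I_isocone x) (I_isocone y)).
  - exact: isoconeD_scalar.
  - exact: isoconeD_scalar.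
  move=> r r' /spectrumD_scalar; rewrite -rmorphB => br.
  move=> /spectrumD_scalar; rewrite -rmorphB => br'.
  have := le_trans (isocone_spectrum_le (A_neq0 x) (I_isocone x) (Ib x) br)
    (le_trans (rnorm_csum_ge b x) bs).
  have := le_trans (isocone_spectrum_le (A_neq0 y) (I_isocone y) (Ib y) br')
    (le_trans (rnorm_csum_ge b y) bs).
  have s0 : 0 <= s := le_trans (rnorm_ge0 b) bs.
  (* Everything below x is below y, and x itself is below y but not below x, so the count grows by
     at least 1. *)
  have : #|[pred u | (u < x)%O]|%:R * (s + s) + (s + s) <=
      #|[pred u | (u < y)%O]|%:R * (s + s).
    rewrite -[X in _ + X]mul1r -mulrDl ler_wpM2r ?addr_ge0 // natr1 ler_nat.
    apply: proper_card; apply/properP; split.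
      by apply/fintype.subsetP => u; rewrite !inE => /lt_trans; apply.
    by exists x; rewrite !inE // ltxx.
  rewrite !ler_norml; lra.
split.
- move=> a [Ia _]; apply: functional_extensionality_dep => x.
  exact: isocone_star (Ia x).
- move=> r; split=> [x|x y xy]; first exact: isocone_cst.
  apply/(set_max_le_minP (A_neq0 x) (A_neq0 y) (I_isocone x) (I_isocone y)).
  + exact: isocone_cst.
  + exact: isocone_cst.
  by move=> s s' /spectrum_scalar[->] /spectrum_scalar[->].
- move=> a b [Ia aP] [Ib bP]; split=> [x|x y xy]; first exact: isoconeD.
  have maxminE := set_max_le_minE (A_neq0 x) (A_neq0 y) (I_isocone x) (I_isocone y).
  move: (aP x y xy) (bP x y xy).
  rewrite (maxminE _ _ (rnorm a)) ?rnorm_csum_ge //; try exact: Ia.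
  rewrite (maxminE _ _ (rnorm b)) ?rnorm_csum_ge //; try exact: Ib.
  (* With the shift ||a|| + ||b||, the shifted sum splits into [a] shifted by ||a|| and [b] shifted
     by ||b||. *)
  rewrite (maxminE _ _ (rnorm a + rnorm b)); last first.
  + by apply: le_trans (rnormD _ _) _; apply: lerD; exact: rnorm_csum_ge.
  + by apply: le_trans (rnormD _ _) _; apply: lerD; exact: rnorm_csum_ge.
  + exact: isoconeD.
  + exact: isoconeD.
  move=> ha hb; apply: le_trans (_ : _ <= _) (le_trans (lerD ha hb) _); last by lra.
  have sC z : (rnorm a + rnorm b)%:C *: (1 : A z) =
      (rnorm a)%:C *: (1 : A z) + (rnorm b)%:C *: (1 : A z) by rewrite rmorphD scalerDl.
  have abE z : (a + b) z = a z + b z by [].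
  rewrite !sC !abE opprD [X in rnorm X + _]addrACA [X in _ + rnorm X]addrACA.
  by apply: le_trans (lerD (rnormD _ _) (rnormD _ _)) _; rewrite addrACA.
- move=> b phi [Ib bP] cphi hphi.
  have cex x : exists c, is_fcalc (b x) phi c /\ I x c.
    by have [c] := isocone_fcalc (I_isocone x) (Ib x) cphi hphi; exists c.
  pose c : csum A := fun x => sval (cid (cex x)).
  have cP x : is_fcalc (b x) phi (c x) /\ I x (c x) by exact: svalP (cid (cex x)).
  exists c; first by apply: csum_is_fcalc => x; have [] := cP x.
  split=> [x|x y xy]; first by have [] := cP x.
  have [bc Ic] := cP x; have [bc' Ic'] := cP y.
  exact: (is_fcalc_max_le_min (A_neq0 x) (A_neq0 y) (I_isocone x) (I_isocone y)
    (Ib x) (Ib y) Ic Ic' cphi hphi bc bc' (bP x y xy)).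
- move=> a /closure_rnorm cla.
  have Ia : csum_set I a.
    move=> x; apply: (isocone_closed (I_isocone x)); apply/closure_rnorm => e e0.
    have [b [Ib _] ab] := cla e e0; exists (b x); first exact: Ib.
    exact: le_lt_trans (rnorm_csum_ge (a - b) x) ab.
  split=> // x y xy.
  have maxminE := set_max_le_minE (A_neq0 x) (A_neq0 y) (I_isocone x) (I_isocone y).
  have le_s z : rnorm (a z) <= rnorm a + 1.
    by apply: le_trans (rnorm_csum_ge a z) _; rewrite lerDl.
  rewrite (maxminE _ _ (rnorm a + 1)) //; set s := rnorm a + 1.
  (* The bound f <= 1 makes s = ||a|| + 1 valid for the approximant too, so one shift serves both; f
     <= e / 2 because two norms are perturbed. *)
  apply/ler_addgt0Pr => e e0; pose f := Num.min 1 (e / 2).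
  have f0 : 0 < f by rewrite lt_min ltr01 divr_gt0.
  have [b [Ib bP] ab] := cla f f0.
  have abz z : rnorm (a z - b z) < f by exact: le_lt_trans (rnorm_csum_ge (a - b) z) ab.
  have le_bs z : rnorm (b z) <= s.
    have -> : b z = a z - (a z - b z) by rewrite opprB addrC subrK.
    apply: le_trans (rnormD _ _) _; rewrite rnormN; apply: lerD (rnorm_csum_ge a z) _.
    by apply: ltW; apply: lt_le_trans (abz z) _; rewrite ge_min lexx.
  have := bP x y xy; rewrite (maxminE _ _ s) // => hb.
  have shift z (r : R) :
      rnorm (a z + r%:C *: (1 : A z)) <= rnorm (b z + r%:C *: (1 : A z)) + f.
    have -> : a z + r%:C *: (1 : A z) = (b z + r%:C *: (1 : A z)) + (a z - b z).
      by rewrite addrAC [b z + _]addrC subrK.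
    by apply: le_trans (rnormD _ _) _; rewrite lerD2l ltW.
  have := shift x s; have := shift y (- s); rewrite rmorphN scaleNr.
  have : f <= e / 2 by rewrite ge_min lexx orbT.
  lra.
- apply/seteqP; split=> [|a asa].
    have /closure_id -> := @closed_selfadjoint R (csum A).
    apply: closure_subset => _ [b [Ib _] [b' [Ib' _] <-]].
    rewrite /selfadjoint /= starB.
    congr (_ - _); apply: functional_extensionality_dep => x.
      exact: isocone_star (Ib x).
    exact: isocone_star (Ib' x).
  apply/closure_rnorm => e e0.
  have approx x : exists p : A x * A x,
      [/\ I x p.1, I x p.2 & rnorm (a x - (p.1 - p.2)) < e].
    have : closure [set b - b' | b in I x & b' in I x] (a x).
      rewrite (isocone_dense (I_isocone x)).
      exact: (congr1 (fun c : csum A => c x) asa).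
    move=> /closure_rnorm /(_ e e0) [_ [b Ib [b' Ib' <-]] ab].
    by exists (b, b').
  pose b : csum A := fun x => (sval (cid (approx x))).1.
  pose b' : csum A := fun x => (sval (cid (approx x))).2.
  have Ib : csum_set I b by move=> x; rewrite /b; case: cid => p [].
  have Ib' : csum_set I b' by move=> x; rewrite /b'; case: cid => p [].
  (* One bound for both elements gives them identical shifts, which cancel in the difference. *)
  have bs : rnorm b <= rnorm b + rnorm b' by rewrite lerDl rnorm_ge0.
  have bs' : rnorm b' <= rnorm b + rnorm b' by rewrite lerDr rnorm_ge0.
  exists (b - b').
    eexists; first exact: Lex_shift Ib bs.
    eexists; first exact: Lex_shift Ib' bs'.
    apply: functional_extensionality_dep => x.
    by rewrite -[LHS]/(_ - _) opprD addrACA subrr addr0.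
  apply: rnorm_csum_lt => // x.
  by rewrite -[(a - (b - b')) x]/(a x - (b x - b' x)) /b /b'; case: cid => p [].
Qed.
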